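(* Let $\{a_0,a_1,\ldots\}$ and $\{b_1,b_2,\ldots\}$ be complex sequences with all $a_i\neq 0$, let $T\in\mathbb{N}$ and $\alpha,\beta\in\mathbb{R}$. Let $y$ be the solution of $$a_ky_{k+1}+a_{k-1}y_{k-1}+b_ky_k=0,\quad k\in\mathbb{N},\qquad y_0=\alpha,\ y_1=\beta,$$ and let $f^T\in\mathcal{F}^T$ be the (unique) control such that $(W^Tf^T)_k=y_k$ for $k=1,\ldots,T$. Let $\varkappa^T$ be the solution of $$\varkappa^T_{t+1}+\varkappa^T_{t-1}=0,\quad t=0,\ldots,T,\qquad \varkappa^T_T=0,\ \varkappa^T_{T-1}=1.$$ Then $f^T$ satisfies the following equation in $\mathcal{F}^T$: $$C^Tf^T=a_0\left[\beta\varkappa^T-\alpha\left(R^T_\#\right)^*\varkappa^T\right].$$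
   Context: $\mathbb{N}=\{1,2,\ldots\}$. For a complex sequence (control) $f=(f_0,f_1,\ldots)$ let $u^f_{n,t}$ be the solution of $$\begin{cases} u_{n,t+1}+u_{n,t-1}-a_n u_{n+1,t}-a_{n-1}u_{n-1,t}-b_n u_{n,t}=0,& n\in\mathbb{N},\ t\in\mathbb{N}\cup\{0\},\\ u_{n,-1}=u_{n,0}=0,& n\in\mathbb{N},\\ u_{0,t}=f_t,& t\in\mathbb{N}\cup\{0\},\end{cases}$$ and let $v^f_{n,t}$ be the solution of the auxiliary system obtained by replacing all $a_n,b_n$ by their complex conjugates $\overline{a_n},\overline{b_n}$ (with the same initial conditions and $v_{0,t}=f_t$). Outer space: $\mathcal{F}^T=\mathbb{C}^T$ with elements $f=(f_0,\ldots,f_{T-1})$ and $(f,g)_{\mathcal{F}^T}=\sum_{k=0}^{T-1}f_k\overline{g_k}$. Inner space: $\mathcal{H}^T=\mathbb{C}^T$ with elements $h=(h_1,\ldots,h_T)$ and $(h,l)_{\mathcal{H}^T}=\sum_{k=1}^T h_k\overline{l_k}$. For $f\in\mathcal{F}^T$ and $n\geq 1$, $t\leq T$, the values $u^f_{n,t}$, $v^f_{n,t}$ depend only on $f_0,\ldots,f_{T-1}$. Control operators $W^T,W^T_\#:\mathcal{F}^T\to\mathcal{H}^T$: $(W^Tf)_n=u^f_{n,T}$, $(W^T_\# f)_n=v^f_{n,T}$, $n=1,\ldots,T$; $W^T$ is an isomorphism. The connecting operator $C^T:\mathcal{F}^T\to\mathcal{F}^T$ is defined by $(C^Tf,g)_{\mathcal{F}^T}=(W^Tf,W^T_\#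 g)_{\mathcal{H}^T}$ for all $f,g\in\mathcal{F}^T$. The response operator of the auxiliary system is $R^T_\#:\mathcal{F}^T\to\mathbb{C}^T$, $(R^T_\#f)_t=v^f_{1,t}$, $t=1,\ldots,T$, where vectors in the target $\mathbb{C}^T$ are indexed by $t=1,\ldots,T$. Meaning of $\varkappa^T$ in the equation: in the first term $\varkappa^T$ denotes $(\varkappa^T_0,\ldots,\varkappa^T_{T-1})\in\mathcal{F}^T$. In the second term the adjoint is applied to $\varkappa^T$ with time indices matched, i.e. $(R^T_\#)^*\varkappa^T\in\mathcal{F}^T$ is the vector determined by $$\left((R^T_\#)^*\varkappa^T,g\right)_{\mathcal{F}^T}=\sum_{t=1}^{T}\varkappa^T_t\,\overline{(R^T_\#g)_t}\qquad\text{for all } g\in\mathcal{F}^T$$ (the term $t=T$ vanishes since $\varkappa^T_T=0$). *)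

(* Defs.v *)
From HB Require Import structures.
From mathcomp Require Import all_boot all_order all_algebra.
From mathcomp Require Export complex.
From mathcomp Require Export reals.
From mathcomp Require Import ring zify.

Set Implicit Arguments.
Unset Strict Implicit.
Unset Printing Implicit Defensive.

Import Order.TTheory GRing.Theory Num.Theory.
Local Open Scope ring_scope.

Section DynamicalSystem.
Variable C : numClosedFieldType.
Implicit Types (a b : nat -> C) (f : nat -> C) (u : nat -> int -> C).

(* Time is an [int] because of the initial layer t = -1.  The value b 0 is
   never used, and u 0 (-1) is left unconstrained. *)
Record wave_solution a b f u : Prop := WaveSolution {
  wave_eq : forall n t : nat, (0 < n)%N ->
    u n (t%:Z + 1) + u n (t%:Z - 1) - a n * u n.+1 t%:Z
      - a n.-1 * u n.-1 t%:Z - b n * u n t%:Z = 0;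
  wave_init : forall n : nat, (0 < n)%N -> u n (-1) = 0 /\ u n 0 = 0;
  wave_bound : forall t : nat, u 0%N t%:Z = f t }.

(* The pair of consecutive time layers (u _ t, u _ (t - 1)). *)
Fixpoint wave_layers a b f (t : nat) : (nat -> C) * (nat -> C) :=
  if t is t'.+1 then
    let: (cur, prev) := wave_layers a b f t' in
    (fun n => if n is m.+1 then
        a m.+1 * cur m.+2 + a m * cur m + b m.+1 * cur m.+1 - prev m.+1
      else f t, cur)
  else (fun n => if n is 0 then f 0%N else 0, fun=> 0).

Definition wave a b f (n : nat) (t : int) : C :=
  if t is Posz t' then (wave_layers a b f t').1 n else 0.

Lemma wave0 a b f n : wave a b f n.+1 0 = 0. Proof. by []. Qed.

Lemma wave_bnd a b f (t : nat) : wave a b f 0%N t%:Z = f t.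
Proof. by case: t => //= t; case: wave_layers. Qed.

Lemma waveS1 a b f m : wave a b f m.+1 1 = a m * wave a b f m 0.
Proof. by rewrite /= !mulr0 add0r addr0 subr0. Qed.

Lemma waveSS a b f m (t : nat) :
  wave a b f m.+1 t.+2%:Z = a m.+1 * wave a b f m.+2 t.+1%:Z
    + a m * wave a b f m t.+1%:Z + b m.+1 * wave a b f m.+1 t.+1%:Z
    - wave a b f m.+1 t%:Z.
Proof. by rewrite /=; case: wave_layers => cur prev. Qed.

Lemma wave_solutionP a b f : wave_solution a b f (wave a b f).
Proof.
split=> [[//|m] t _|[//|m] _|t]; rewrite ?wave_bnd //.
case: t => [|t].
  rewrite add0r waveS1 sub0r /= addr0 !mulr0 !subr0; case: m => [|m] /=;
  by rewrite subrr.
have -> : t.+1%:Z + 1 = t.+2%:Z by rewrite -PoszD addn1.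
have -> : t.+1%:Z - 1 = t%:Z by rewrite -addn1 PoszD addrK.
rewrite waveSS subrK -!addrA -!opprD /=.
by apply/eqP; rewrite !addrA subr_eq0.
Qed.

Lemma wave_solution_uniq a b f u u' :
    wave_solution a b f u -> wave_solution a b f u' ->
  forall n (t : nat), u n t%:Z = u' n t%:Z.
Proof.
move=> hu hu' n t.
suff: forall n, u n t%:Z = u' n t%:Z /\
    ((0 < n)%N -> u n (t%:Z - 1) = u' n (t%:Z - 1)) by move=> /(_ n)[].
elim: t => [|t IH] {}n.
  split; last by move=> n0; rewrite sub0r (wave_init hu n0).1 (wave_init hu' n0).1.
  case: n => [|n]; first by rewrite (wave_bound hu 0) (wave_bound hu' 0).
  by rewrite (wave_init hu _).2 // (wave_init hu' _).2.
have e : t.+1%:Z - 1 = t%:Z by rewrite -addn1 PoszD addrK.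
rewrite e; split; last by move=> _; have [] := IH n.
case: n => [|n]; first by rewrite (wave_bound hu) (wave_bound hu').
have := wave_eq hu t (ltn0Sn n); have := wave_eq hu' t (ltn0Sn n).
rewrite -PoszD addn1 /= (IH n.+2).1 (IH n).1 (IH n.+1).1 (IH n.+1).2 //.
by move=> <- /addIr/addIr/addIr/addIr.
Qed.

Lemma wave_causal a b f f' T : (forall t, (t < T)%N -> f t = f' t) ->
  forall n (t : nat), (0 < n)%N -> (t <= T)%N ->
  wave a b f n t%:Z = wave a b f' n t%:Z.
Proof.
move=> ff'.
have H : forall t, (t <= T)%N ->
    (forall n, wave a b f n.+1 t%:Z = wave a b f' n.+1 t%:Z) /\
    (forall n, wave a b f n.+1 t.-1%:Z = wave a b f' n.+1 t.-1%:Z).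
  elim=> [|[|t] IH] tT //.
    split=> // n; rewrite !waveS1; case: n => [|n] //.
    by rewrite !(wave_bnd _ _ _ 0) ff'.
  have [IH1 IH2] := IH (ltnW tT); split=> // n.
  rewrite !waveSS !IH1 IH2; case: n => [|n]; last by rewrite IH1.
  by rewrite !wave_bnd ff'.
by case=> // n t _ tT; rewrite (H t tT).1.
Qed.

(* Row vectors stand for both spaces: f = (f_0, ..., f_(T-1)) in the outer
   space has f 0 t = f_t, whereas h = (h_1, ..., h_T) in the inner space, and
   vectors indexed by times 1, ..., T, have h 0 k = h_(k+1).  The inner product
   of both spaces is the library's [dotmx]. *)
Lemma dotmx_sum T (g h : 'rV[C]_T) :
  dotmx g h = \sum_(k < T) g 0 k * (h 0 k)^*.
Proof. by rewrite dotmxE mxE; apply: eq_bigr => k _; rewrite !mxE. Qed.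

(* Extension by zero; by [wave_causal] any other extension gives the same
   values u n t for n >= 1 and t <= T. *)
Definition control_seq T (f : 'rV[C]_T) (t : nat) : C :=
  if insub t is Some i then f 0 i else 0.

Definition control_op a b T (f : 'rV[C]_T) : 'rV[C]_T :=
  \row_(n < T) wave a b (control_seq f) n.+1 T%:Z.

Definition response_op a b T (f : 'rV[C]_T) : 'rV[C]_T :=
  \row_(t < T) wave a b (control_seq f) 1 t.+1%:Z.

Definition conj_seq (c : nat -> C) (n : nat) : C := (c n)^*.

Definition aux_control_op a b := control_op (conj_seq a) (conj_seq b).
Definition aux_response_op a b := response_op (conj_seq a) (conj_seq b).

Definition is_connecting_op a b T (CT : 'rV[C]_T -> 'rV[C]_T) : Prop :=
  forall f g : 'rV[C]_T,
    dotmx (CT f) g = dotmx (control_op a b f) (aux_control_op a b g).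

Definition is_adjoint T (A Astar : 'rV[C]_T -> 'rV[C]_T) : Prop :=
  forall h g : 'rV[C]_T, dotmx (Astar h) g = dotmx h (A g).

Lemma wave_linear a b f f' c n (t : int) :
  wave a b (fun s => c * f s + f' s) n t
    = c * wave a b f n t + wave a b f' n t.
Proof.
case: t => t; last by rewrite /= mulr0 addr0.
suff: forall n, wave a b (fun s => c * f s + f' s) n t%:Z
      = c * wave a b f n t%:Z + wave a b f' n t%:Z /\
   wave a b (fun s => c * f s + f' s) n t.+1%:Z
      = c * wave a b f n t.+1%:Z + wave a b f' n t.+1%:Z.
  by move=> /(_ n)[].
have H0 m : wave a b (fun s => c * f s + f' s) m 0
      = c * wave a b f m 0 + wave a b f' m 0.
  by case: m => [|m] //=; rewrite mulr0 addr0.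
elim: t => [|t IH] m.
  split=> //; case: m => [|m]; first by rewrite !wave_bnd.
  by rewrite !waveS1 H0 mulrDr mulrCA.
split; first by have [] := IH m.
case: m => [|m]; first by rewrite !wave_bnd.
rewrite !waveSS (IH m.+2).2 (IH m).2 (IH m.+1).2 (IH m.+1).1.
by ring.
Qed.

Lemma control_seq_linear T c (f g : 'rV[C]_T) :
  control_seq (c *: f + g) =1 (fun s => c * control_seq f s + control_seq g s).
Proof.
by move=> t; rewrite /control_seq; case: insubP => [i _ _|_];
  rewrite ?mxE // mulr0 addr0.
Qed.

Fact control_op_linear a b T : linear (@control_op a b T).
Proof.
move=> c f g; apply/rowP=> n; rewrite !mxE -wave_linear.
by apply: (@wave_causal _ _ _ _ T) => // t _; rewrite control_seq_linear.
Qed.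
HB.instance Definition _ a b T :=
  GRing.isLinear.Build C 'rV[C]_T 'rV[C]_T _ (@control_op a b T)
    (@control_op_linear a b T).

Fact response_op_linear a b T : linear (@response_op a b T).
Proof.
move=> c f g; apply/rowP=> n; rewrite !mxE -wave_linear.
by apply: (@wave_causal _ _ _ _ T) => // t _; rewrite control_seq_linear.
Qed.
HB.instance Definition _ a b T :=
  GRing.isLinear.Build C 'rV[C]_T 'rV[C]_T _ (@response_op a b T)
    (@response_op_linear a b T).

Lemma wave_front a b f j : (forall i, (i < j)%N -> f i = 0) ->
  (forall n t, (t < n + j)%N -> wave a b f n t%:Z = 0) /\
  (forall n, wave a b f n (n + j)%N%:Z = (\prod_(i < n) a i) * f j).
Proof.
move=> f0.
have Z : forall n t, (t < n + j)%N -> wave a b f n t%:Z = 0.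
  move=> n t; elim/ltn_ind: t n => -[|[|t]] IH [|n] lt //.
  - by rewrite wave_bnd f0.
  - by rewrite wave_bnd f0.
  - by rewrite waveS1 (IH 0%N) ?mulr0 // -ltnS -addSn.
  - by rewrite wave_bnd f0.
  rewrite waveSS !IH ?mulr0 ?addr0 ?subr0 //; lia.
split=> //; elim=> [|n IH]; first by rewrite wave_bnd big_ord0 mul1r.
have -> : (n.+1 + j = (n + j).+1)%N by [].
have -> : \prod_(i < n.+1) a i = (\prod_(i < n) a i) * a n by rewrite big_ord_recr.
rewrite mulrAC -IH mulrC.
case E : (n + j)%N => [|t]; first exact: waveS1.
rewrite waveSS (Z n.+2) ?(Z n.+1 t.+1) ?(Z n.+1 t); try lia.
by rewrite !mulr0 add0r addr0 subr0.
Qed.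

Lemma control_op_bij a b T : (forall i, a i != 0) ->
  bijective (@control_op a b T).
Proof.
move=> a0; pose M := lin1_mx (@control_op a b T).
have inj : forall f : 'rV[C]_T, control_op a b f = 0 -> f = 0.
  move=> f Wf; suff H : forall j, (j < T)%N -> control_seq f j = 0.
    apply/rowP=> i; have := H i (ltn_ord i).
    by rewrite mxE /control_seq valK.
  elim/ltn_ind=> j IH jT.
  have [|_ /(_ (T - j)%N)] := @wave_front a b (control_seq f) j.
    by move=> i ij; apply: IH => //; apply: ltn_trans jT.
  rewrite subnK; last exact: ltnW.
  have nT : ((T - j).-1 < T)%N.
    by rewrite prednK ?subn_gt0 // leq_subr.
  have := congr1 (fun h : 'rV_T => h 0 (Ordinal nT)) Wf.
  rewrite !mxE /= prednK ?subn_gt0 // => -> /esym/eqP.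
  rewrite mulf_eq0 => /orP[/prodf_eq0[i _]|/eqP//].
  by rewrite (negbTE (a0 i)).
have uM : M \in unitmx.
  rewrite -row_free_unit -kermx_eq0; apply/eqP/row_matrixP=> i.
  rewrite row0; apply: inj; rewrite -(mul_rV_lin1 (@control_op a b T)).
  by rewrite -row_mul mulmx_ker row0.
exists (fun h => h *m invmx M) => h; rewrite -[control_op a b _]mul_rV_lin1.
  exact: mulmxK.
exact: mulmxKV.
Qed.

Lemma dotmx_inj T (u v : 'rV[C]_T) :
  (forall g, dotmx u g = dotmx v g) -> u = v.
Proof.
move=> uv; apply/rowP=> k; have := uv (delta_mx 0 k).
have dotk (w : 'rV[C]_T) : dotmx w (delta_mx 0 k) = w 0 k.
  rewrite (dotmx_sum w) (bigD1 k) //= big1 ?addr0; last first.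
    by move=> i /negbTE ik; rewrite mxE ik andbF conjC0 mulr0.
  by rewrite mxE !eqxx conjC1 mulr1.
by rewrite !dotk.
Qed.

Lemma adjoint_exists T (A : {linear 'rV[C]_T -> 'rV[C]_T}) :
  exists Astar, is_adjoint A Astar.
Proof.
exists (fun h => h *m (map_mx Num.conj (lin1_mx A))^T) => h g.
by rewrite !dotmxE -(mul_rV_lin1 A g) trmx_mul map_mxM -mulmxA map_trmx.
Qed.

Lemma adjoint_unique T (A B B' : 'rV[C]_T -> 'rV[C]_T) :
  is_adjoint A B -> is_adjoint A B' -> B =1 B'.
Proof. by move=> hB hB' h; apply: dotmx_inj => g; rewrite hB hB'. Qed.

Lemma connecting_op_exists a b T :
  exists CT : 'rV[C]_T -> 'rV[C]_T, is_connecting_op a b CT.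
Proof.
have [S hS] := @adjoint_exists T (@control_op (conj_seq a) (conj_seq b) T).
by exists (fun h => S (control_op a b h)) => h g; rewrite hS.
Qed.

Lemma connecting_op_unique a b T (B B' : 'rV[C]_T -> 'rV[C]_T) :
  is_connecting_op a b B -> is_connecting_op a b B' -> B =1 B'.
Proof. by move=> hB hB' h; apply: dotmx_inj => g; rewrite hB hB'. Qed.

End DynamicalSystem.

(* Main.v *)
(* For a control g, the conjugate of v^g solves the original wave equation with
   control g^*; pair it with y in space and call the result S_t.  Since y is a
   stationary solution, Green's formula leaves only boundary terms:
     S_(t+1) + S_(t-1) = a_0 (beta g_t^* - alpha (v^g_(1,t))^* ),
   the far boundary term vanishing by finite propagation speed.  As S starts
   from rest, testing this against kappa_t gives S_T, by the constancy of the
   discrete Wronskian up to the forcing; and S_T = (C^T f, g). *)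
Require Import Defs.
From mathcomp Require Import all_boot all_order all_algebra.
From mathcomp Require Import complex reals.
From mathcomp Require Import ring zify.

Set Implicit Arguments.
Unset Strict Implicit.
Unset Printing Implicit Defensive.

Import Order.TTheory GRing.Theory Num.Theory.
Local Open Scope ring_scope.

Section WavePairing.
Variable C : numClosedFieldType.
Implicit Types (a b f y w : nat -> C).

Lemma wave_conj a b f n t :
  (wave (conj_seq a) (conj_seq b) f n t)^* = wave a b (conj_seq f) n t.
Proof.
have conjM c m (z : C) : (conj_seq c m * z)^* = c m * z^*.
  by rewrite rmorphM /= conjCK.
have conjD (z z' : C) : (z + z')^* = z^* + z'^* by exact: rmorphD.
have conjB (z z' : C) : (z - z')^* = z^* - z'^* by exact: rmorphB.
case: t => t; last by rewrite /= conjC0.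
elim/ltn_ind: t n => -[|[|t]] IH [|n]; rewrite ?wave_bnd //.
- by rewrite /= conjC0.
- by rewrite !waveS1 conjM (IH 0%N).
by rewrite !waveSS conjB !conjD !conjM !IH.
Qed.

Lemma wave_eqE a b f n (t : nat) :
  wave a b f n.+1 (t%:Z + 1) + wave a b f n.+1 (t%:Z - 1) =
  a n.+1 * wave a b f n.+2 t%:Z + a n * wave a b f n t%:Z
    + b n.+1 * wave a b f n.+1 t%:Z.
Proof.
have /(_ n.+1 t isT) /= := wave_eq (wave_solutionP a b f).
by move/eqP; rewrite -!addrA -!opprD addrA subr_eq0 => /eqP ->; rewrite !addrA.
Qed.

(** The Jacobi operator evaluated at site [n.+1]: the shift avoids predecessors and keeps site 0 as
    boundary data. *)
Definition jacobi a b w (n : nat) : C :=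
  a n.+1 * w n.+2 + a n * w n + b n.+1 * w n.+1.

(** The [b] terms cancel, and the [k]-th summand is the increment from [k] to [k.+1] of the weighted
    Wronskian [a k * (y k * w k.+1 - y k.+1 * w k)], so the sum telescopes. *)
Lemma jacobi_green a b y w N :
  \sum_(k < N) (y k.+1 * jacobi a b w k - w k.+1 * jacobi a b y k) =
  a 0%N * (y 1%N * w 0%N - y 0%N * w 1%N)
    + a N * (y N * w N.+1 - y N.+1 * w N).
Proof.
elim: N => [|N IH]; first by rewrite big_ord0; ring.
by rewrite big_ord_recr /= IH /jacobi; ring.
Qed.

Definition wave_pairing a b f y T (t : int) : C :=
  \sum_(k < T) y k.+1 * wave a b f k.+1 t.

Lemma wave_pairing_step a b f y T (t : nat) :
    (forall k, jacobi a b y k = 0) -> (t < T)%N ->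
  wave_pairing a b f y T (t%:Z + 1) + wave_pairing a b f y T (t%:Z - 1) =
  a 0%N * (y 1%N * f t - y 0%N * wave a b f 1 t%:Z).
Proof.
move=> y_eq tT; rewrite /wave_pairing -big_split /=.
have [//|front _] := @wave_front _ a b f 0.
rewrite -(wave_bnd a b f t).
have := jacobi_green a b y (fun n => wave a b f n t%:Z) T.
(* Since [t < T], the wave has reached neither site [T] nor [T.+1]. *)
rewrite (front T.+1) ?(front T) ?addn0 //; last exact: ltnW.
rewrite !mulr0 subrr mulr0 addr0 => <-.
by apply: eq_bigr => k _; rewrite -mulrDr wave_eqE y_eq mulr0 subr0.
Qed.

(** The left side is a Wronskian in time. As [kappa (t + 1) = - kappa (t - 1)], one time step
    increases it by exactly [kappa t * (S (t + 1) + S (t - 1))]. *)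
Lemma discrete_duhamel (S kappa : int -> C) (t : nat) :
    S 0 = 0 -> S (-1) = 0 ->
    (forall s : nat, (s < t)%N -> kappa (s%:Z + 1) + kappa (s%:Z - 1) = 0) ->
  kappa (t%:Z - 1) * S t%:Z - kappa t%:Z * S (t%:Z - 1) =
  \sum_(s < t) kappa s%:Z * (S (s%:Z + 1) + S (s%:Z - 1)).
Proof.
move=> S0 S1; elim: t => [|t IH] kappa_eq.
  by rewrite big_ord0 S0 sub0r S1 !mulr0 subr0.
rewrite big_ord_recr /= -IH => [|s st]; last exact/kappa_eq/ltnW.
have -> : t.+1%:Z - 1 = t%:Z by lia.
have -> : t.+1%:Z = t%:Z + 1 by lia.
have /eqP := kappa_eq t (ltnSn t); rewrite addr_eq0 => /eqP ->; ring.
Qed.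

Lemma control_seqE T (g : 'rV[C]_T) (t : 'I_T) : control_seq g t = g 0 t.
Proof. by rewrite /control_seq valK. Qed.

End WavePairing.

Local Open Scope complex_scope.

Theorem theorem2 (R : realType) (a b : nat -> R[i]) (T : nat)
    (alpha beta : R) (y : nat -> R[i]) (f : 'rV[R[i]]_T)
    (kappa : int -> R[i])
    (CT RTstar : 'rV[R[i]]_T -> 'rV[R[i]]_T)
    (a_neq0 : forall i : nat, a i != 0)
    (T_gt0 : (0 < T)%N)
    (y_eq : forall k : nat, (0 < k)%N ->
       a k * y k.+1 + a k.-1 * y k.-1 + b k * y k = 0)
    (y0 : y 0%N = alpha%:C) (y1 : y 1%N = beta%:C)
    (f_ctrl : control_op a b f = \row_(k < T) y k.+1)
    (kappa_eq : forall t : nat, (t <= T)%N ->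
       kappa (t%:Z + 1) + kappa (t%:Z - 1) = 0)
    (kappa_T : kappa T%:Z = 0) (kappa_T1 : kappa (T%:Z - 1) = 1)
    (CT_conn : is_connecting_op a b CT)
    (RTstar_adj : is_adjoint (@aux_response_op _ a b T) RTstar) :
  CT f = a 0%N *: (beta%:C *: (\row_(t < T) kappa t%:Z)
           - alpha%:C *: RTstar (\row_(t < T) kappa t.+1%:Z)).
Proof.
have jac_y k : jacobi a b y k = 0 by exact: (y_eq k.+1).
apply: dotmx_inj => g; rewrite CT_conn f_ctrl.
pose h := conj_seq (control_seq g).
pose S := wave_pairing a b h y T.
have -> : dotmx (\row_(k < T) y k.+1) (aux_control_op a b g) = S T%:Z.
  by rewrite dotmx_sum; apply: eq_bigr => k _; rewrite !mxE wave_conj.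
have S0 : S 0 = 0 by rewrite /S /wave_pairing big1 // => k _; rewrite mulr0.
have S1 : S (-1) = 0 by rewrite /S /wave_pairing big1 // => k _; rewrite mulr0.
have := discrete_duhamel S0 S1 (fun s (sT : (s < T)%N) => kappa_eq s (ltnW sT)).
(* The terminal data of [kappa] reduce the Wronskian at time [T] to [S T]. *)
rewrite kappa_T kappa_T1 mul1r mul0r subr0 => ->.
have adjE : dotmx (RTstar (\row_(t < T) kappa t.+1%:Z)) g =
    \sum_(t < T) kappa t%:Z * wave a b h 1 t%:Z.
  rewrite RTstar_adj dotmx_sum.
  under eq_bigr do rewrite !mxE wave_conj.
  (* The adjoint sums over times 1 to [T], the goal over 0 to [T - 1]. Both equal the sum over 0 to
     [T]: the term at [T] vanishes with [kappa], the one at 0 with the wave at rest. *)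
  have := @big_ord_recl _ 0 +%R T (fun t => kappa t%:Z * wave a b h 1 t%:Z).
  rewrite big_ord_recr /= kappa_T mul0r addr0 mulr0 add0r => ->.
  by apply: eq_bigr.
rewrite linearZl_LR /= linearBl !linearZl_LR /= adjE dotmx_sum.
rewrite !mulr_sumr -sumrB mulr_sumr; apply: eq_bigr => t _.
rewrite wave_pairing_step // y0 y1 !mxE /h /conj_seq control_seqE; ring.
Qed.
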